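(* Let $F$ be $\ell$-cocoercive. Let the key parametric assumption hold with constants $A,B,C,D_1,D_2\ge0$, $\rho\in(0,1]$ and variables $\{\sigma_k\}_{k\ge0}$, and let $\mathcal{C}\subset\mathbb{R}^d$ be a compact convex set with $X^*\subset\mathcal{C}$. Assume that $$0<\gamma\le\min\left\{\frac1\ell,\ \frac{1}{2(A+BC/\rho)}\right\}.$$ Then for all $K\ge1$ the iterates of SGDA with constant stepsize $\gamma$ satisfy $$\begin{aligned}\mathbb{E}\left[\mathrm{Gap}_{\mathcal{C}}\left(\frac1K\sum_{k=1}^Kx^k\right)\right]\le\ &\frac{3\max_{u\in\mathcal{C}}\|x^0-u\|^2}{2\gamma K}+\left(6A+3\ell+\frac{12BC}{\rho}\right)\frac{\|x^0-x^{*,0}\|^2}{K}\\&+\left(6+\left(6A+3\ell+\frac{12BC}{\rho}\right)\gamma\right)\frac{\gamma B\sigma_0^2}{\rho K}\\&+\gamma\left(3+\gamma\left(6A+3\ell+\frac{12BC}{\rho}\right)\right)\left(D_1+\frac{2BD_2}{\rho}\right).\end{aligned}$$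
   Context: Norms and inner products on $\mathbb{R}^d$ are Euclidean. $F:\mathbb{R}^d\to\mathbb{R}^d$ is an operator and $R:\mathbb{R}^d\to\mathbb{R}\cup\{+\infty\}$ is a proper lower semicontinuous convex function. $X^*$ is the (nonempty) set of solutions of the regularized variational inequality: find $x^*\in\mathbb{R}^d$ with $\langle F(x^* ),x-x^*\rangle+R(x)-R(x^* )\ge0$ for all $x\in\mathbb{R}^d$. $\mathrm{proj}_{X^*}(x)=\arg\min_{y\in X^*}\|y-x\|$ (taken to be well defined). $F$ is $\ell$-cocoercive ($\ell>0$) if $\|F(x)-F(y)\|^2\le\ell\langle F(x)-F(y),x-y\rangle$ for all $x,y\in\mathbb{R}^d$. Restricted gap function: $\mathrm{Gap}_{\mathcal{C}}(z)=\max_{u\in\mathcal{C}}[\langle F(u),z-u\rangle+R(z)-R(u)]$ (maximum understood as supremum). SGDA: $x^{k+1}=\mathrm{prox}_{\gamma R}(x^k-\gamma g^k)$, where $\mathrm{prox}_{\gamma R}(x)=\arg\min_{y}\{R(y)+\|y-x\|^2/(2\gamma)\}$ and $g^k$ is a random vector; $x^0$ and $\sigma_0$ are deterministic. Put $x^{*,k}=\mathrm{proj}_{X^*}(x^k)$ and $g^{*,k}=F(x^{*,k})$. $\mathbb{E}_k[\cdot]$ is the expectation with respect to the randomness at iteration $k$, i.e. conditional on everything generated before iteration $k$ (in particular on $x^k,\sigma_k$). Key parametric assumption: for all $k\ge0$, $\mathbb{E}_k[g^k]=F(x^k)$, and there are constants $A,B,C,D_1,D_2\ge0$, $\rho\in(0,1]$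 and (possibly random) nonnegative variables $\{\sigma_k\}_{k\ge0}$ such that for all $k\ge0$ $$\mathbb{E}_k\|g^k-g^{*,k}\|^2\le2A\langle F(x^k)-g^{*,k},x^k-x^{*,k}\rangle+B\sigma_k^2+D_1,$$ $$\mathbb{E}_k[\sigma_{k+1}^2]\le2C\langle F(x^k)-g^{*,k},x^k-x^{*,k}\rangle+(1-\rho)\sigma_k^2+D_2.$$ *)

(* Defs.v *)
From HB Require Import structures.
From mathcomp Require Import all_boot all_order all_algebra.
From mathcomp Require Import all_classical all_reals all_analysis.
From mathcomp Require Import measurable_realfun.
Set Implicit Arguments.
Unset Strict Implicit.
Unset Printing Implicit Defensive.
Import Order.TTheory GRing.Theory Num.Theory.
Import numFieldNormedType.Exports.
Local Open Scope classical_set_scope.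
Local Open Scope ring_scope.

(* The library norm on 'rV[R]_n is the sup norm; it induces the same topology
   as the Euclidean norm below, so `compact` and `lower_semicontinuous` are
   used as they are. *)
Definition dotv (R : realType) (n : nat) (u v : 'rV[R]_n) : R :=
  \sum_(i < n) u 0 i * v 0 i.

Definition enorm (R : realType) (n : nat) (u : 'rV[R]_n) : R :=
  Num.sqrt (dotv u u).

Definition cocoercive (R : realType) (n : nat) (ell : R)
    (F : 'rV[R]_n -> 'rV[R]_n) : Prop :=
  forall x y, enorm (F x - F y) ^+ 2 <= ell * dotv (F x - F y) (x - y).

Definition eproper (R : realType) (n : nat) (r : 'rV[R]_n -> \bar R) : Prop :=
  (forall x, r x != -oo%E) /\ (exists x, r x != +oo%E).

Definition econvex (R : realType) (n : nat) (r : 'rV[R]_n -> \bar R) : Prop :=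
  forall (x y : 'rV[R]_n) (t : R), 0 <= t <= 1 ->
    (r (t *: x + (1 - t) *: y)%R <= t%:E * r x + (1 - t)%R%:E * r y)%E.

Definition is_argmin (R : realType) (n : nat) (A : set 'rV[R]_n)
    (f : 'rV[R]_n -> \bar R) (p : 'rV[R]_n) : Prop :=
  A p /\ forall y, A y -> (f p <= f y)%E.

Definition is_proj (R : realType) (n : nat) (A : set 'rV[R]_n)
    (x p : 'rV[R]_n) : Prop :=
  is_argmin A (fun y => (enorm (y - x))%:E) p.

Definition is_prox (R : realType) (n : nat) (gamma : R)
    (r : 'rV[R]_n -> \bar R) (x p : 'rV[R]_n) : Prop :=
  is_argmin setT
    (fun y => (r y + (enorm (y - x) ^+ 2 / (2 * gamma))%R%:E)%E) p.

(* As +oo - +oo = -oo in \bar R, every element of this set has a finite value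
   of r when r is proper. *)
Definition vi_sol (R : realType) (n : nat) (F : 'rV[R]_n -> 'rV[R]_n)
    (r : 'rV[R]_n -> \bar R) : set 'rV[R]_n :=
  [set xs | forall x, (0 <= (dotv (F xs) (x - xs))%R%:E + r x - r xs)%E].

(* By the same convention, a point u with r u = +oo contributes -oo. *)
Definition gap (R : realType) (n : nat) (F : 'rV[R]_n -> 'rV[R]_n)
    (r : 'rV[R]_n -> \bar R) (S : set 'rV[R]_n) (z : 'rV[R]_n) : \bar R :=
  ereal_sup [set ((dotv (F u) (z - u))%R%:E + r z - r u)%E | u in S].

Definition filtration (d : measure_display) (T : measurableType d)
    (Fil : nat -> set (set T)) : Prop :=
  [/\ forall k, sigma_algebra setT (Fil k),
      forall k, Fil k `<=` measurable &
      forall k, Fil k `<=` Fil k.+1].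

(* For a sigma-algebra G, the measurable sets of g_sigma_algebraType G are
   exactly the elements of G. *)
Definition measurable_wrt (d : measure_display) (T : measurableType d)
    (d' : measure_display) (U : measurableType d') (G : set (set T))
    (f : T -> U) : Prop :=
  measurable_fun [set: g_sigma_algebraType G] (f : g_sigma_algebraType G -> U).

(* Y is a version of E[X | G], for X nonnegative or integrable. *)
Definition is_cond_exp (d : measure_display) (T : measurableType d)
    (R : realType) (P : probability T R) (G : set (set T))
    (X Y : T -> \bar R) : Prop :=
  [/\ measurable_fun setT X,
      (forall w, (0 <= X w)%E) \/ P.-integrable setT X,
      measurable_wrt G Y &
      forall A, G A -> (\int[P]_(w in A) Y w = \int[P]_(w in A) X w)%E].

(* E[X | G] <= Z almost surely; the version chosen is irrelevant. *)
Definition cond_exp_le (d : measure_display) (T : measurableType d)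
    (R : realType) (P : probability T R) (G : set (set T))
    (X Z : T -> \bar R) : Prop :=
  exists2 Y, is_cond_exp P G X Y & {ae P, forall w, (Y w <= Z w)%E}.

(* Fil k is the information available before iteration k, so that g k, which
   is drawn during iteration k, is only Fil k.+1-measurable. *)
Definition sgda (d : measure_display) (T : measurableType d) (R : realType)
    (n : nat) (Fil : nat -> set (set T)) (gamma : R)
    (r : 'rV[R]_n -> \bar R) (x0 : 'rV[R]_n) (x g : nat -> T -> 'rV[R]_n) :
    Prop :=
  [/\ forall w, x 0%N w = x0,
      forall k w, is_prox gamma r (x k w - gamma *: g k w) (x k.+1 w),
      forall k i, measurable_wrt (Fil k) (fun w => x k w 0 i) &
      forall k i, measurable_wrt (Fil k.+1) (fun w => g k w 0 i)].

Definition key_assumption (d : measure_display) (T : measurableType d)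
    (R : realType) (P : probability T R) (n : nat) (Fil : nat -> set (set T))
    (F proj : 'rV[R]_n -> 'rV[R]_n) (x g : nat -> T -> 'rV[R]_n)
    (sigma : nat -> T -> R) (A B C D1 D2 rho : R) : Prop :=
  let xs k w := proj (x k w) in
  let gs k w := F (xs k w) in
  let h k w := dotv (F (x k w) - gs k w) (x k w - xs k w) in
  [/\ forall k w, 0 <= sigma k w,
      forall k, measurable_wrt (Fil k) (sigma k),
      forall k i, is_cond_exp P (Fil k)
        (fun w => (g k w 0 i)%:E) (fun w => (F (x k w) 0 i)%:E),
      forall k, cond_exp_le P (Fil k)
        (fun w => (enorm (g k w - gs k w) ^+ 2)%:E)
        (fun w => (2 * A * h k w + B * sigma k w ^+ 2 + D1)%:E) &
      forall k, cond_exp_le P (Fil k)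
        (fun w => (sigma k.+1 w ^+ 2)%:E)
        (fun w => (2 * C * h k w + (1 - rho) * sigma k w ^+ 2 + D2)%:E)].

(* Main.v *)
Require Import Defs.
From HB Require Import structures.
From mathcomp Require Import all_boot all_order all_algebra.
From mathcomp Require Import all_classical all_reals all_analysis.
From mathcomp Require Import measurable_realfun ring lra.
Set Implicit Arguments.
Unset Strict Implicit.
Unset Printing Implicit Defensive.
Import Order.TTheory GRing.Theory Num.Theory.
Import numFieldNormedType.Exports.
Import HBNNSimple.
Local Open Scope classical_set_scope.
Local Open Scope ring_scope.

(* All solutions share the value q = F(x^* ), and by cocoercivity the solution
   set is convex, so the projection is nonexpansive and g^{*,k} = q.

   Let e_k = F(x^k) - g^k. Optimality of the prox step, together with
   cocoercivity of F between x^k and u, gives for every u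
     2 gamma (<F(u), x^{k+1} - u> + R(x^{k+1}) - R(u))
       <= |x^k - u|^2 - |x^{k+1} - u|^2 + 2 gamma <e_k, x^k - u>
          + 2 gamma^2 |e_k|^2.
   After summation the only noise term depending on u is
   2 gamma <sum_k e_k, x^0 - u>, bounded by
   2 |x^0 - u|^2 + (gamma^2 / 2) |sum_k e_k|^2. Taking expectations, the terms
   <e_k, x^k - x^0> vanish and E|sum_k e_k|^2 = sum_k E|e_k|^2 because the e_k
   are martingale differences. Finally E_k|e_k|^2 <= E_k|g^k - q|^2, and the sum
   of these is controlled by the Lyapunov function
   |x^k - x^{*,k}|^2 + (B / rho) gamma^2 sigma_k^2. *)

(** * Euclidean geometry and deterministic steps *)

Section Euclidean.
Variables (R : realType) (n : nat).
Implicit Types u v w x y : 'rV[R]_n.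

Lemma dotvC u v : dotv u v = dotv v u.
Proof. by apply: eq_bigr => i _; rewrite mulrC. Qed.

Lemma dotvDl u v w : dotv (u + v) w = dotv u w + dotv v w.
Proof. by rewrite -big_split; apply: eq_bigr => i _; rewrite mxE mulrDl. Qed.

Lemma dotvZl a u v : dotv (a *: u) v = a * dotv u v.
Proof. by rewrite mulr_sumr; apply: eq_bigr => i _; rewrite mxE mulrA. Qed.

Lemma dotvNl u v : dotv (- u) v = - dotv u v.
Proof. by rewrite -scaleN1r dotvZl mulN1r. Qed.

Lemma dotvDr u v w : dotv w (u + v) = dotv w u + dotv w v.
Proof. by rewrite dotvC dotvDl !(dotvC w). Qed.

Lemma dotvZr a u v : dotv v (a *: u) = a * dotv v u.
Proof. by rewrite dotvC dotvZl dotvC. Qed.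

Lemma dotvNr u v : dotv v (- u) = - dotv v u.
Proof. by rewrite dotvC dotvNl dotvC. Qed.

Definition dotvE := (dotvDl, dotvDr, dotvNl, dotvNr, dotvZl, dotvZr).

Lemma dotv0l v : dotv 0 v = 0.
Proof. by rewrite -(scale0r v) dotvZl mul0r. Qed.

Lemma dotv0r v : dotv v 0 = 0. Proof. by rewrite dotvC dotv0l. Qed.

Lemma dotv_ge0 u : 0 <= dotv u u.
Proof. by apply: sumr_ge0 => i _; rewrite -expr2 sqr_ge0. Qed.

Lemma dotv_suml (I : Type) (s : seq I) (p : pred I) (f : I -> 'rV[R]_n) v :
  dotv (\sum_(i <- s | p i) f i) v = \sum_(i <- s | p i) dotv (f i) v.
Proof.
elim/big_rec2: _ => [|i y1 y2 _ <-]; last by rewrite dotvDl.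
by rewrite dotv0l.
Qed.

Lemma enorm_sqr u : enorm u ^+ 2 = dotv u u.
Proof. by rewrite sqr_sqrtr ?dotv_ge0. Qed.

Lemma enorm_ge0 u : 0 <= enorm u. Proof. exact: sqrtr_ge0. Qed.

Lemma enorm_sub u v : enorm (u - v) = enorm (v - u).
Proof. by rewrite /enorm -(opprB v) dotvNl dotvNr opprK. Qed.

Lemma le_enorm u v : (enorm u <= enorm v) = (dotv u u <= dotv v v).
Proof. by rewrite ler_sqrt ?dotv_ge0. Qed.

Lemma le_enormZ a u v : 0 <= a ->
  (enorm u <= a * enorm v) = (dotv u u <= a ^+ 2 * dotv v v).
Proof.
move=> a0; rewrite -!enorm_sqr -exprMn ler_pXn2r// ?nnegrE ?enorm_ge0//.
by rewrite mulr_ge0// enorm_ge0.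
Qed.

Lemma le_coord_enorm u i : `|u 0 i| <= enorm u.
Proof.
rewrite -sqrtr_sqr ler_sqrt ?dotv_ge0// /dotv (bigD1 i)//= -expr2 lerDl.
by apply: sumr_ge0 => j _; rewrite -expr2 sqr_ge0.
Qed.

Lemma enorm_le_sum u : enorm u <= \sum_(i < n) `|u 0 i|.
Proof.
have s0 : 0 <= \sum_(i < n) `|u 0 i| by apply: sumr_ge0.
rewrite -(ger0_norm s0) -sqrtr_sqr ler_sqrt ?sqr_ge0//.
rewrite expr2 mulr_sumr; apply: ler_sum => i _.
rewrite -expr2 -real_normK ?num_real// expr2 ler_wpM2r//.
by rewrite (bigD1 i)//= lerDl sumr_ge0.
Qed.

(* First-order optimality conditions are obtained by letting t tend to 0. *)
Lemma le0_of_quadratic (a b : R) :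
  (forall t, 0 < t <= 1 -> t * a <= t ^+ 2 * b) -> a <= 0.
Proof.
move=> h; rewrite leNgt; apply/negP => a0.
have b0 : 0 < b.
  by have := h 1; rewrite ltr01 lexx expr1n !mul1r => /(_ isT); lra.
have ab0 : 0 < a + b by rewrite addr_gt0.
(* For this [t] one has [a - t * b = t * a > 0], whereas the hypothesis divided by [t] says
   [a <= t * b]. *)
set t := a / (a + b).
have t0 : 0 < t by rewrite divr_gt0.
have tab : t * (a + b) = a by rewrite divfK ?gt_eqF.
have t1 : t <= 1 by rewrite ler_pdivrMr// mul1r lerDl ltW.
have := h t; rewrite t0 t1 expr2 -mulrA => /(_ isT).
rewrite ler_pM2l// => H.
have : 0 < t * a by rewrite mulr_gt0.
by lra.
Qed.

(** * Projection onto a convex set *)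

Section Projection.
Variable A : set 'rV[R]_n.
Hypothesis convA : forall x y (t : R), A x -> A y -> 0 <= t <= 1 ->
  A (t *: x + (1 - t) *: y).

(** Comparing [p] with the point [t *: z + (1 - t) *: p] of [A] and expanding the squares gives
    [2 t <x - p, z - p> <= t^2 |z - p|^2]. *)
Lemma proj_obtuse x p z : is_proj A x p -> A z -> dotv (x - p) (z - p) <= 0.
Proof.
move=> [Ap pmin] Az.
suff : 2 * dotv (x - p) (z - p) <= 0 by lra.
apply: (@le0_of_quadratic _ (dotv (z - p) (z - p))) => t /andP[t0 t1].
have /pmin : A (t *: z + (1 - t) *: p) by apply: convA => //; rewrite ltW.
rewrite lee_fin le_enorm.
have -> : t *: z + (1 - t) *: p - x = t *: (z - p) - (x - p).
  by rewrite scalerBr scalerBl scale1r; apply/rowP => i; rewrite !mxE; lra.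
rewrite -(opprB x p) !dotvE; move: (dotvC z p) (dotvC x p) (dotvC x z) => -> -> ->.
lra.
Qed.

(** Adding the two obtuse-angle inequalities gives [|px - py|^2 <= <px - py, x - y>]; nonnegativity
    of [|(x - y) - (px - py)|^2] then replaces Cauchy-Schwarz. *)
Lemma proj_nonexpansive x y px py : is_proj A x px -> is_proj A y py ->
  enorm (px - py) <= enorm (x - y).
Proof.
move=> hx hy; rewrite le_enorm.
have := proj_obtuse hx hy.1; have := proj_obtuse hy hx.1.
have := dotv_ge0 ((x - y) - (px - py)).
rewrite !dotvE (dotvC py px) (dotvC px x) (dotvC py x) (dotvC px y) (dotvC py y).
rewrite (dotvC y x); lra.
Qed.

End Projection.

(** * Proximal points, solutions of the variational inequality, cocoercivity *)

Section RegularizedVI.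
Variables (F : 'rV[R]_n -> 'rV[R]_n) (r : 'rV[R]_n -> \bar R).
Hypotheses (r_proper : eproper r) (r_convex : econvex r).

Lemma is_prox_fin_num gamma z p : is_prox gamma r z p -> r p \is a fin_num.
Proof.
case: r_proper => rNy [y ry] [_ /(_ y I)].
case: (r p) (rNy p) => [s| |]//= _.
by case: (r y) (rNy y) ry.
Qed.

(** This is the subgradient inequality for [(z - p) / gamma] at [p], obtained without
    subdifferentials: minimality of [p] is tested at [t *: u + (1 - t) *: p], convexity bounds [r]
    there, and [t] tends to 0. *)
Lemma prox_ineq gamma z p u : 0 < gamma -> is_prox gamma r z p ->
  r u \is a fin_num ->
  gamma * (fine (r p) - fine (r u)) <= dotv (u - p) (p - z).
Proof.
move=> g0 hp; have := is_prox_fin_num hp; move: hp => [_ pmin].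
move: (pmin) => _ /fineK rp /fineK ru.
rewrite -subr_le0 -(pmulr_rle0 _ (ltr0n R 2)).
apply: (@le0_of_quadratic _ (dotv (u - p) (u - p))) => t /andP[t0 t1].
have := pmin (t *: u + (1 - t) *: p) I.
have := r_convex u p (t := t); rewrite (ltW t0) t1 => /(_ isT).
case: (r _) (r_proper.1 (t *: u + (1 - t) *: p)) => [s| |]// _.
  rewrite -rp -ru -!EFinM -!EFinD !lee_fin !enorm_sqr => cvx.
  have -> : t *: u + (1 - t) *: p - z = (p - z) + t *: (u - p).
    by rewrite scalerBr scalerBl scale1r; apply/rowP => i; rewrite !mxE; lra.
  set v := u - p; set w := p - z => H.
  have {}H : 2 * gamma * (fine (r p) - s) <= dotv (w + t *: v) (w + t *: v) - dotv w w.
    have g20 : 0 < 2 * gamma by lra.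
    have : (2 * gamma) * (fine (r p) + dotv w w / (2 * gamma)) <=
      (2 * gamma) * (s + dotv (w + t *: v) (w + t *: v) / (2 * gamma)).
      by rewrite ler_pM2l.
    rewrite !(mulrDr (2 * gamma)) !(mulrC (2 * gamma) (_ / _)) !divfK ?gt_eqF//; lra.
  have {}cvx : 2 * gamma * (t * (fine (r p) - fine (r u))) <= 2 * gamma * (fine (r p) - s).
    by rewrite ler_pM2l; lra.
  clearbody v w; move: H cvx; rewrite !dotvE (dotvC v w) expr2 => H cvx.
  have : 2 * gamma * (t * (fine (r p) - fine (r u))) <=
     2 * t * dotv w v + t * t * dotv v v by lra.
  lra.
(* The value [+oo] at the convex combination is excluded, because convexity bounds it by a finite
   number. *)
by rewrite -rp -ru -!EFinM -!EFinD.
Qed.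

Lemma vi_sol_fin_num xs : vi_sol F r xs -> r xs \is a fin_num.
Proof.
case: r_proper => rNy [y ry] /(_ y).
case: (r xs) (rNy xs) => [s| |]//= _.
by case: (r y) (rNy y) ry.
Qed.

Lemma vi_sol_ineq xs x : vi_sol F r xs -> r x \is a fin_num ->
  0 <= dotv (F xs) (x - xs) + fine (r x) - fine (r xs).
Proof.
move=> hxs /fineK rx; have /fineK rxs := vi_sol_fin_num hxs.
by have := hxs x; rewrite -rx -rxs -!EFinD lee_fin.
Qed.

(** Induction on the number of points: the new average is the combination of the old one and the new
    point with weight [t = (K + 1) / (K + 2)]. Indices start at 1 because only outputs of the prox
    have a value of [r] known to be finite; [r (x 0)] may be [+oo]. *)
Lemma jensen_avg (x : nat -> 'rV[R]_n) K : (0 < K)%N ->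
  (forall k, r (x k.+1) \is a fin_num) ->
  let z := K%:R^-1 *: \sum_(1 <= k < K.+1) x k in
  r z \is a fin_num /\
  K%:R * fine (r z) <= \sum_(1 <= k < K.+1) fine (r (x k)).
Proof.
move=> + rx; case: K => // K _; cbv zeta; elim: K => [|K [rz IH]].
  by rewrite !big_nat1 invr1 scale1r; split => //; rewrite mul1r.
rewrite !(@big_nat_recr _ _ _ K.+2)//=.
set S := \sum_(_ <= _ < K.+2) _ in rz IH *.
set Z := _^-1 *: S in rz IH *.
pose t : R := K.+1%:R / K.+2%:R.
have k2 : K.+2%:R != 0 :> R by rewrite pnatr_eq0.
have k1 : K.+1%:R != 0 :> R by rewrite pnatr_eq0.
have tK : K.+2%:R * t = K.+1%:R by rewrite mulrC divfK.
have t1 : 1 - t = K.+2%:R^-1.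
  by rewrite /t -[X in X - _](mulfV k2) -mulrBl -natrB// subSnn mul1r.
have -> : K.+2%:R^-1 *: (S + x K.+2) = t *: Z + (1 - t) *: x K.+2.
  by rewrite t1 scalerDr /Z scalerA /t -mulrA mulrCA mulfV// mulr1.
have := r_convex Z (x K.+2) (t := t).
have -> : 0 <= t <= 1.
  by rewrite divr_ge0//= ler_pdivrMr ?ltr0n// mul1r ler_nat.
move=> /(_ isT); rewrite -(fineK rz) -(fineK (rx K.+1)) -!EFinM -!EFinD.
case: (r _) (r_proper.1 (t *: Z + (1 - t) *: x K.+2)) => [s| |]//= _.
rewrite lee_fin => hs; split => //.
apply: le_trans (lerD IH (lexx _)).
have -> : K.+1%:R * fine (r Z) + fine (r (x K.+2)) =
   K.+2%:R * (t * fine (r Z) + (1 - t) * fine (r (x K.+2))).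
  by rewrite mulrDr t1 (mulrA _ t) tK mulrA mulfV// mul1r.
by rewrite ler_pM2l// ltr0n.
Qed.

Variables (ell : R) (ell_gt0 : 0 < ell) (F_cocoercive : cocoercive ell F).

Lemma cocoerciveE x y :
  dotv (F x - F y) (F x - F y) <= ell * dotv (F x - F y) (x - y).
Proof. by rewrite -enorm_sqr. Qed.

(** With [a = F x - F y] and [b = x - y], expanding [|a - ell b|^2 >= 0] and inserting
    [|a|^2 <= ell <a, b>] suffices. *)
Lemma cocoercive_lipschitz x y :
  enorm (F x - F y) <= ell * enorm (x - y).
Proof.
rewrite le_enormZ; last exact: ltW.
have := cocoerciveE x y.
set a := F x - F y; set b := x - y => h; clearbody a b.
have := dotv_ge0 (a - ell *: b); rewrite !dotvE (dotvC b a); lra.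
Qed.

Lemma cocoercive_monotone x y : 0 <= dotv (F x - F y) (x - y).
Proof.
have := le_trans (dotv_ge0 (F x - F y)) (cocoerciveE x y).
by rewrite pmulr_rge0.
Qed.

Lemma dotv_eq0 u : dotv u u <= 0 -> u = 0.
Proof.
rewrite -enorm_sqr => u0; apply/rowP => i; rewrite mxE.
have e0 : enorm u = 0.
  by apply/eqP; rewrite -sqrf_eq0 eq_le u0 sqr_ge0.
by apply/eqP; rewrite -normr_eq0 eq_le normr_ge0 andbT -e0 le_coord_enorm.
Qed.

(** Testing each solution against the other and adding gives [<F x - F y, x - y> <= 0], which
    cocoercivity turns into [|F x - F y|^2 <= 0]. *)
Lemma vi_sol_F_const x y : vi_sol F r x -> vi_sol F r y -> F x = F y.
Proof.
move=> hx hy; apply/eqP; rewrite -subr_eq0; apply/eqP/dotv_eq0.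
apply: le_trans (cocoerciveE x y) _.
rewrite pmulr_rle0//.
have := vi_sol_ineq hx (vi_sol_fin_num hy).
have := vi_sol_ineq hy (vi_sol_fin_num hx).
rewrite !dotvE; lra.
Qed.

(* On a segment joining two solutions with common value q of F, averaging the
   two cocoercivity inequalities forces F = q. *)
Lemma vi_sol_convex x y t : vi_sol F r x -> vi_sol F r y -> 0 <= t <= 1 ->
  vi_sol F r (t *: x + (1 - t) *: y).
Proof.
move=> hx hy t01; have Fxy := vi_sol_F_const hx hy.
have rx := vi_sol_fin_num hx; have ry := vi_sol_fin_num hy.
set m := t *: x + (1 - t) *: y.
have /andP[t0 t1] := t01.
have Fm : F m = F x.
  apply/eqP; rewrite -subr_eq0; apply/eqP/dotv_eq0.
  have hmx := cocoerciveE m x; have hmy := cocoerciveE m y.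
  rewrite -Fxy in hmy; set a := F m - F x in hmx hmy *.
  have -> : dotv a a = t * dotv a a + (1 - t) * dotv a a by lra.
  have -> : 0 = t * (ell * dotv a (m - x)) + (1 - t) * (ell * dotv a (m - y)).
    rewrite !(mulrCA _ ell) -mulrDr -!dotvZr -dotvDr.
    suff -> : t *: (m - x) + (1 - t) *: (m - y) = 0.
      by rewrite dotv0r mulr0.
    by apply/rowP => i; rewrite !mxE; ring.
  by apply: lerD; rewrite ler_wpM2l// subr_ge0.
(* Since [F m = F x = F y], the inequality at [m] follows from the [t]-average of those at [x] and
   [y] and convexity of [r]. *)
move=> z; have := r_convex x y t01; rewrite -/m.
rewrite -(fineK rx) -(fineK ry) -!EFinM -!EFinD.
case: (r m) (r_proper.1 m) => [s| |]//= _; rewrite lee_fin => hs.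
have [rz|] := boolP (r z \is a fin_num).
  rewrite -(fineK rz) -!EFinD lee_fin Fm.
  have zx := vi_sol_ineq hx rz; have zy := vi_sol_ineq hy rz; rewrite -Fxy in zy.
  have : 0 <= t * (dotv (F x) (z - x) + fine (r z) - fine (r x)) +
     (1 - t) * (dotv (F x) (z - y) + fine (r z) - fine (r y)).
    by rewrite addr_ge0// mulr_ge0// subr_ge0.
  rewrite /m !dotvE; lra.
by case: (r z) (r_proper.1 z) => [?| |]//= _ _; rewrite leey.
Qed.

(** * One proximal step *)

Section Step.
Variables (gamma : R) (x g p : 'rV[R]_n).
Hypotheses (gamma_gt0 : 0 < gamma) (hp : is_prox gamma r (x - gamma *: g) p).

(** A solution [xs] is a fixed point of the exact step, so this is nonexpansiveness of the prox.
    With [v] and [w] the two differences, [prox_ineq] at [xs] and the variational inequality at [p]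
    give [|v|^2 <= <v, w>]. *)
Lemma prox_step_contract xs : vi_sol F r xs ->
  dotv (p - xs) (p - xs) <=
  dotv (x - xs - gamma *: (g - F xs)) (x - xs - gamma *: (g - F xs)).
Proof.
move=> hxs; have := prox_ineq gamma_gt0 hp (vi_sol_fin_num hxs).
have := vi_sol_ineq hxs (is_prox_fin_num hp).
rewrite -(pmulr_rge0 _ gamma_gt0).
have -> : xs - p = - (p - xs) by rewrite opprB.
have -> : p - (x - gamma *: g) =
   (p - xs) - (x - xs - gamma *: (g - F xs)) + gamma *: F xs.
  by apply/rowP => i; rewrite !mxE; ring.
set v := p - xs; set w := x - xs - _.
clearbody v w; have := dotv_ge0 (v - w).
rewrite !dotvE (dotvC v (F xs)) (dotvC w v); lra.
Qed.

Lemma prox_step_gap u : gamma * ell <= 1 -> r u \is a fin_num ->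
  2 * gamma * (dotv (F u) (p - u) + fine (r p) - fine (r u)) <=
  dotv (x - u) (x - u) - dotv (p - u) (p - u)
  + 2 * gamma * dotv (F x - g) (x - u)
  + 2 * gamma ^+ 2 * dotv (F x - g) (F x - g).
Proof.
move=> gell ru; have := prox_ineq gamma_gt0 hp ru.
have := cocoerciveE x u.
have -> : x - u = (p - u) - (p - x) by apply/rowP => i; rewrite !mxE; ring.
have -> : u - p = - (p - u) by rewrite opprB.
have -> : p - (x - gamma *: g) = (p - x) + gamma *: F x - gamma *: (F x - g).
  by apply/rowP => i; rewrite !mxE; ring.
set e := F x - g; set v := p - u; set D := p - x.
set a := F x - F u.
have -> : gamma *: F x = gamma *: F u + gamma *: a.
  by rewrite -scalerDr addrC subrK.
(* The term [|D|^2] from the expansion of [|x - u|^2] is split in halves: [h1] spends one on the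
   noise product [<D, e>], and [h2] the other on [<D, a>], together with the cocoercivity gain
   [2 gamma^2 |a|^2]. *)
have h1 := dotv_ge0 (D - (2 * gamma) *: e).
have h2 := dotv_ge0 (D + (2 * gamma) *: a).
rewrite -/v => coc.
have {}coc : gamma * dotv a a <= dotv a (v - D).
  have m0 : 0 <= dotv a (v - D).
    by rewrite -(pmulr_rge0 _ ell_gt0) (le_trans (dotv_ge0 a)).
  apply: le_trans (_ : gamma * ell * dotv a (v - D) <= _).
    by rewrite -mulrA ler_pM2l.
  by rewrite ler_piMl.
have {}coc : gamma * (gamma * dotv a a) <= gamma * dotv a (v - D).
  by rewrite ler_pM2l.
clearbody v D a e; move: h1 h2 coc; rewrite !dotvE (dotvC D e) (dotvC D a) (dotvC D v).
rewrite (dotvC v (F u)) (dotvC v a) (dotvC v e); lra.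
Qed.
End Step.

End RegularizedVI.
End Euclidean.

(** * Square-integrable vectors *)

Section LipschitzMeasurable.
Variables (R : realType) (n : nat).

Lemma exists_rat_near (y : 'rV[R]_n) (e : R) : 0 < e ->
  exists q : 'rV[rat]_n, \sum_(i < n) `|y 0 i - ratr (q 0 i)| < e.
Proof.
(* Dividing by [n + 1] keeps the total error [n * dl] strictly below [e] and covers [n = 0]. *)
move=> e0; pose dl := e / n.+1%:R.
have d0 : 0 < dl by rewrite divr_gt0.
have /choice[q hq] : forall i, exists q : rat, `|y 0 i - ratr q| < dl.
  move=> i; have /rat_in_itvoo[q] : y 0 i - dl < y 0 i + dl by lra.
  rewrite in_itv/= => /andP[q1 q2]; exists q.
  by rewrite distrC ltr_norml; apply/andP; split; lra.
exists (\row_i q i); apply: le_lt_trans (_ : n%:R * dl < e).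
  rewrite -[n in n%:R]card_ord mulr_natl -sumr_const; apply: ler_sum => i _.
  by rewrite mxE ltW.
by rewrite /dl mulrCA gtr_pMr// ltr_pdivrMr// mul1r ltr_nat.
Qed.

(* {f(X) < a} is the union over rational points q of
   {f(q) + L |X - q|_1 < a}. *)
Lemma measurable_lipschitz (d : measure_display) (T : measurableType d)
    (f : 'rV[R]_n -> R) (L : R) (X : T -> 'rV[R]_n) : 0 < L ->
  (forall x y, `|f x - f y| <= L * enorm (x - y)) ->
  (forall i, measurable_fun setT (fun w => X w 0 i)) ->
  measurable_fun setT (fun w => f (X w)).
Proof.
move=> L0 lipf mX mT; apply: (measurability _ (RGenInftyO.measurableE R)) => //.
move=> _ [_ [a ->] <-].
pose rv (q : 'rV[rat]_n) : 'rV[R]_n := \row_i ratr (q 0 i).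
pose l1 (q : 'rV[rat]_n) w := \sum_(i < n) `|X w 0 i - ratr (q 0 i)|.
have lip1 q w : `|f (X w) - f (rv q)| <= L * l1 q w.
  apply: le_trans (lipf _ _) _; rewrite ler_pM2l//.
  apply: le_trans (enorm_le_sum _) _; apply: ler_sum => i _.
  by rewrite !mxE.
rewrite [X in measurable X](_ : _ =
    \bigcup_(q : 'rV[rat]_n) [set w | f (rv q) + L * l1 q w < a]); last first.
  apply/seteqP; split => w /=.
    rewrite in_itv/= => -[_ fa].
    (* This radius works because [f(q) + L |X - q|_1 <= f(X) + 2 L |X - q|_1 < a]. *)
    have [q hq] : exists q : 'rV[rat]_n, l1 q w < (a - f (X w)) / (2 * L).
      by apply: exists_rat_near; rewrite divr_gt0// ?mulr_gt0// subr_gt0.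
    exists q => //=; move: hq; rewrite ltr_pdivlMr ?mulr_gt0//.
    have := lip1 q w; rewrite ler_norml => /andP[]; lra.
  move=> [q _] /= qa; split => //; rewrite in_itv/=.
  have := lip1 q w; rewrite ler_norml => /andP[]; lra.
apply: countable_bigcupT_measurable => [|q]; first exact: countableP.
have mq : measurable_fun setT (fun w => f (rv q) + L * l1 q w).
  apply: measurable_funD => //; apply: measurable_funM => //.
  apply: measurable_sum => i; apply: measurableT_comp => //.
  exact: measurable_funB.
have := mq measurableT `]-oo, a[%classic (measurable_itv _).
by rewrite setTI.
Qed.

End LipschitzMeasurable.

Section SquareIntegrable.
Variables (R : realType) (d : measure_display) (T : measurableType d).
Variable P : probability T R.
Implicit Types f g : T -> R.

Local Notation int1 f := (P.-integrable setT (EFin \o f)).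
Local Notation "''E' f" := (\int[P]_w f w) (at level 10, f at level 8).

Definition sq_integrable f :=
  measurable_fun setT f /\ int1 (fun w => f w ^+ 2).

Lemma integrable_dom f g : measurable_fun setT f ->
  (forall w, `|f w| <= g w) -> int1 g -> int1 f.
Proof.
move=> mf fg; apply: le_integrable => //; first exact/measurable_EFinP.
by move=> w _ /=; rewrite lee_fin (le_trans (fg w))// ler_norm.
Qed.

Lemma int1D f g : int1 f -> int1 g -> int1 (fun w => f w + g w).
Proof. by move=> hf hg; exact: (integrableD measurableT hf hg). Qed.

Lemma int1B f g : int1 f -> int1 g -> int1 (fun w => f w - g w).
Proof. by move=> hf hg; exact: (integrableB measurableT hf hg). Qed.

Lemma int1Z k f : int1 f -> int1 (fun w => k * f w).
Proof. by move=> hf; exact: (integrableZl measurableT k hf). Qed.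

Lemma int1_cst k : int1 (fun=> k).
Proof. exact: finite_measure_integrable_cst. Qed.

Lemma int1_sum (I : Type) (s : seq I) (p : pred I) (h : I -> T -> R) :
  (forall i, p i -> int1 (h i)) -> int1 (fun w => \sum_(i <- s | p i) h i w).
Proof.
move=> hh; have := integrable_sum measurableT s hh.
by apply: eq_integrable => // w _; rewrite /= sumEFin.
Qed.

Lemma ED f g : int1 f -> int1 g -> 'E (fun w => f w + g w) = 'E f + 'E g.
Proof. exact: RintegralD. Qed.

Lemma EB f g : int1 f -> int1 g -> 'E (fun w => f w - g w) = 'E f - 'E g.
Proof. exact: RintegralB. Qed.

Lemma EZ k f : int1 f -> 'E (fun w => k * f w) = k * 'E f.
Proof. exact: RintegralZl. Qed.

Lemma Ele f g : int1 f -> int1 g -> (forall w, f w <= g w) -> 'E f <= 'E g.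
Proof. by move=> hf hg fg; exact: le_Rintegral. Qed.

Lemma Ecst k : 'E (fun=> k) = k.
Proof.
rewrite Rintegral_cst// -[RHS]mulr1; congr (_ * _).
by rewrite -[RHS]/(fine 1%E) -(probability_setT P).
Qed.

Lemma Esum (I : Type) (s : seq I) (h : I -> T -> R) :
  (forall i, int1 (h i)) ->
  'E (fun w => \sum_(i <- s) h i w) = \sum_(i <- s) 'E (h i).
Proof.
move=> hh; elim: s => [|i s IH].
  by under eq_Rintegral do rewrite big_nil; rewrite big_nil Ecst.
under eq_Rintegral do rewrite big_cons.
by rewrite ED ?IH ?big_cons//; exact: int1_sum.
Qed.

Lemma sq_integrableM f g : sq_integrable f -> sq_integrable g ->
  int1 (fun w => f w * g w).
Proof.
move=> [mf hf] [mg hg]; apply: integrable_dom (int1D hf hg).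
  exact: measurable_funM.
move=> w /=; rewrite ler_norml.
have := sqr_ge0 (f w + g w); have := sqr_ge0 (f w - g w).
have := sqr_ge0 (f w); have := sqr_ge0 (g w).
by rewrite !expr2 => *; apply/andP; split; lra.
Qed.

Lemma sq_integrableD f g : sq_integrable f -> sq_integrable g ->
  sq_integrable (fun w => f w + g w).
Proof.
move=> hf hg; have hfg := sq_integrableM hf hg.
move: hf hg => [mf hf] [mg hg]; split; first exact: measurable_funD.
have := int1D (int1D hf hg) (int1Z 2 hfg).
by apply: eq_integrable => // w _ /=; congr EFin; rewrite !expr2; lra.
Qed.

Lemma sq_integrableZ k f : sq_integrable f -> sq_integrable (fun w => k * f w).
Proof.
move=> [mf hf]; split; first exact: measurable_funM.
have := int1Z (k ^+ 2) hf.
by apply: eq_integrable => // w _ /=; rewrite exprMn.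
Qed.

Lemma sq_integrable_cst k : sq_integrable (fun=> k).
Proof. by split => //; exact: int1_cst. Qed.

Lemma sq_integrable_int1 f : sq_integrable f -> int1 f.
Proof.
move=> hf; have := sq_integrableM hf (sq_integrable_cst 1).
by apply: eq_integrable => // w _ /=; rewrite mulr1.
Qed.

Variable n : nat.
Implicit Types X Y : T -> 'rV[R]_n.

Definition vsq_integrable X := forall i, sq_integrable (fun w => X w 0 i).

Lemma vsq_integrableD X Y : vsq_integrable X -> vsq_integrable Y ->
  vsq_integrable (fun w => X w + Y w).
Proof.
move=> hX hY i; under [fun w => _]eq_fun do rewrite mxE.
exact: sq_integrableD.
Qed.

Lemma vsq_integrableZ k X : vsq_integrable X ->
  vsq_integrable (fun w => k *: X w).
Proof.
by move=> hX i; under [fun w => _]eq_fun do rewrite mxE; exact: sq_integrableZ.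
Qed.

Lemma vsq_integrableB X Y : vsq_integrable X -> vsq_integrable Y ->
  vsq_integrable (fun w => X w - Y w).
Proof.
move=> hX hY; under [fun w => _]eq_fun do rewrite -scaleN1r.
by apply: vsq_integrableD => //; exact: vsq_integrableZ.
Qed.

Lemma vsq_integrable_cst v : vsq_integrable (fun=> v).
Proof. by move=> i; exact: sq_integrable_cst. Qed.

Lemma vsq_integrable_sum (I : Type) (s : seq I) (X : I -> T -> 'rV[R]_n) :
  (forall i, vsq_integrable (X i)) ->
  vsq_integrable (fun w => \sum_(i <- s) X i w).
Proof.
move=> hX; elim: s => [|i s IH].
  under [fun w => _]eq_fun do rewrite big_nil; exact: vsq_integrable_cst.
by under [fun w => _]eq_fun do rewrite big_cons; exact: vsq_integrableD.
Qed.

Lemma int1_dotv X Y : vsq_integrable X -> vsq_integrable Y ->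
  int1 (fun w => dotv (X w) (Y w)).
Proof. by move=> hX hY; apply: int1_sum => i _; exact: sq_integrableM. Qed.

Lemma vsq_integrable_dom X f :
  (forall i, measurable_fun setT (fun w => X w 0 i)) ->
  (forall w, dotv (X w) (X w) <= f w) -> int1 f -> vsq_integrable X.
Proof.
move=> mX Xf hf i; split => //; apply: integrable_dom hf.
  exact: measurable_funX.
move=> w; rewrite ger0_norm ?sqr_ge0//; apply: le_trans (Xf w).
by rewrite /dotv (bigD1 i)//= -expr2 lerDl sumr_ge0// => j _; rewrite -expr2 sqr_ge0.
Qed.

End SquareIntegrable.

(** * Conditional expectation *)

Section ConditionalExpectation.
Variables (R : realType) (d : measure_display) (T : measurableType d).
Variable P : probability T R.

Local Notation int1 f := (P.-integrable setT (EFin \o f)).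
Local Notation "''E' f" := (\int[P]_w f w) (at level 10, f at level 8).

Section SubSigmaAlgebra.
Variable G : set (set T).
Hypotheses (Gsig : sigma_algebra setT G) (Gmeas : G `<=` measurable).

Lemma measurable_wrtP (d' : measure_display) (U : measurableType d')
    (f : T -> U) :
  measurable_wrt G f <-> forall B, measurable B -> G (f @^-1` B).
Proof.
have GE : <<s G >> = G := sigma_algebra_id Gsig.
split=> [mf B mB|h _ B mB].
  by have := mf measurableT B mB; rewrite setTI /measurable/= GE.
by rewrite setTI /measurable/= GE; exact: h.
Qed.

Lemma measurable_wrtW (d' : measure_display) (U : measurableType d')
    (f : T -> U) : measurable_wrt G f -> measurable_fun setT f.
Proof.
by move=> /measurable_wrtP h _ B mB; rewrite setTI; exact/Gmeas/h.
Qed.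

(** [W] is the increasing limit of simple functions whose level sets lie in [G]. Against each of
    them the integral of [Z] vanishes by linearity, and dominated convergence with bound [|Z W|]
    passes to the limit. *)
Lemma integral_mul_orthogonal_ge0 (Z W : T -> R) :
  int1 Z -> (forall A, G A -> \int[P]_(w in A) Z w = 0) ->
  measurable_wrt G W -> (forall w, 0 <= W w) ->
  int1 (fun w => Z w * W w) -> 'E (fun w => Z w * W w) = 0.
Proof.
move=> iZ Z0 mW W0 iZW.
have mZ : measurable_fun setT Z.
  by apply/measurable_EFinP; case/integrableP : iZ.
have mW' : measurable_fun [set: g_sigma_algebraType G]
    (EFin \o (W : g_sigma_algebraType G -> R)) by exact/measurable_EFinP.
(* The approximation is built on [g_sigma_algebraType G], not on [T], so that the level sets of
   [h k] belong to [G]. *)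
pose h k (w : T) : R := nnsfun_approx measurableT mW' k w.
have hW w : h k w @[k --> \oo] --> W w.
  have W0' v : [set: g_sigma_algebraType G] v -> (0 <= (W v)%:E)%E.
    by rewrite lee_fin.
  exact: (fine_cvg (cvg_nnsfun_approx measurableT mW' W0' (x := w) I)).
have hleW k w : h k w <= W w.
  have nd : {homo h ^~ w : a b / (a <= b)%N >-> a <= b}.
    by move=> a b /(nd_nnsfun_approx measurableT mW')/lefP; exact.
  have hc : cvgn (h ^~ w) := cvgP _ (hW w).
  by have := nondecreasing_cvgn_le nd hc k; rewrite (cvg_lim _ (hW w)).
have h0 k w : 0 <= h k w by exact: fun_ge0.
have mh k : measurable_fun setT (h k).
  apply: measurable_wrtW.
  exact: (@measurable_funP _ _ _ _ _ (nnsfun_approx measurableT mW' k)).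
have Ehk k : 'E (fun w => Z w * h k w) = 0.
  have hE w : Z w * h k w = \sum_(y <- finmap.enum_fset (fset_set (range (h k))))
     y * (Z \_ (h k @^-1` [set y])) w.
    have -> : h k w = \sum_(y <- finmap.enum_fset (fset_set (range (h k))))
        y * \1_(h k @^-1` [set y]) w.
      rewrite -fsbig_finite/=; last exact: (fimfunP (nnsfun_approx measurableT mW' k)).
      exact: (fimfunE (nnsfun_approx measurableT mW' k) w).
    rewrite mulr_sumr; apply: eq_bigr => y _.
    by rewrite patch_indic mulrCA.
  under eq_Rintegral do rewrite hE.
  have GA y : G (h k @^-1` [set y]).
    have /measurable_wrtP : measurable_wrt G (h k).
      exact: (@measurable_funP _ _ _ _ _ (nnsfun_approx measurableT mW' k)).
    by apply; exact: measurable_set1.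
  have iA y : int1 (Z \_ (h k @^-1` [set y])).
    have := (integrable_mkcond (EFin \o Z) (Gmeas (GA y))).1.
    rewrite restrict_EFin; apply.
    by apply: integrableS iZ => //; exact: Gmeas (GA y).
  rewrite Esum; last by move=> y; exact: int1Z.
  rewrite big1// => y _; rewrite EZ// -Rintegral_mkcond Z0 ?mulr0//.
have := @dominated_convergence _ _ _ P setT measurableT
  (fun k w => (Z w * h k w)%:E) (fun w => (Z w * W w)%:E)
  (fun w => `|Z w * W w|%:E).
case.
- by move=> k; apply/measurable_EFinP; exact: measurable_funM.
- by case/integrableP : iZW.
- by apply: aeW => w _; apply: cvg_EFin; [near=> k|apply: cvgM; [exact: cvg_cst|exact: hW]].
- exact: integrable_abse iZW.
- apply: aeW => w k _; rewrite lee_fin !normrM ler_wpM2l//.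
  by rewrite !ger0_norm.
move=> _ _ /=.
rewrite [X in X @ _ --> _](_ : _ = fun=> 0%E); last first.
  apply/funext => k; have := Ehk k; rewrite /Rintegral.
  have /(integrable_fin_num measurableT) : int1 (fun w => Z w * h k w).
    apply: integrable_dom (integrable_norm iZW); first exact: measurable_funM.
    by move=> w /=; rewrite !normrM ler_wpM2l// !ger0_norm.
  by move=> /fineK /= <- /= ->.
move=> cv; rewrite /Rintegral.
suff -> : (\int[P]_w (Z w * W w)%:E)%E = 0%E by [].
by apply: (cvg_unique _ cv (cvg_cst _)).
Unshelve. all: end_near. Qed.

(** Write [W = (|W| + W) - |W|], a difference of nonnegative [G]-measurable functions whose products
    with [Z] are still integrable. *)
Lemma integral_mul_orthogonal (Z W : T -> R) :
  int1 Z -> (forall A, G A -> \int[P]_(w in A) Z w = 0) ->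
  measurable_wrt G W -> int1 (fun w => Z w * W w) ->
  'E (fun w => Z w * W w) = 0.
Proof.
move=> iZ Z0 mW iZW.
have mZW : measurable_fun setT (fun w => Z w * W w).
  by apply/measurable_EFinP; case/integrableP : iZW.
have mZ : measurable_fun setT Z.
  by apply/measurable_EFinP; case/integrableP : iZ.
have mN : measurable_wrt G (fun w => `|W w|).
  exact: (measurableT_comp (@normr_measurable _ setT) mW).
have mS : measurable_wrt G (fun w => `|W w| + W w) := measurable_funD mN mW.
have iN : int1 (fun w => Z w * `|W w|).
  apply: integrable_dom (integrable_norm iZW).
    by apply: measurable_funM => //; exact: measurable_wrtW.
  by move=> w /=; rewrite !normrM normr_id.
have iS : int1 (fun w => Z w * (`|W w| + W w)).
  have := int1D iN iZW.
  by apply: eq_integrable => // w _ /=; rewrite mulrDr.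
have E1 := integral_mul_orthogonal_ge0 iZ Z0 mN (fun=> normr_ge0 _) iN.
have E2 : 'E (fun w => Z w * (`|W w| + W w)) = 0.
  apply: integral_mul_orthogonal_ge0 => // w.
  by have := ler_norm (- W w); rewrite normrN; lra.
rewrite -[RHS](subrr 0) -{1}E2 -E1 -EB//.
by apply: eq_Rintegral => w _; ring.
Qed.

Lemma sub_sigma_setT : G setT.
Proof. by case: Gsig => G0 /(_ _ G0); rewrite setD0. Qed.

Lemma cond_exp_residual (X Y : T -> R) : int1 X -> int1 Y ->
  is_cond_exp P G (EFin \o X) (EFin \o Y) ->
  forall A, G A -> \int[P]_(w in A) (Y w - X w) = 0.
Proof.
move=> iX iY [_ _ _ h] A GA; have mA := Gmeas GA.
rewrite RintegralB//; [|by apply: integrableS iY|by apply: integrableS iX].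
by rewrite /Rintegral; have /= -> := h A GA; rewrite subrr.
Qed.

(** Taking [A = setT] in the conditional expectation gives equal integrals for [X] and its version
    [Y]. Integrability of [X] is a conclusion, which lets second moments propagate from one
    iteration to the next. *)
Lemma cond_exp_le_expectation (X Z : T -> R) : (forall w, 0 <= X w) ->
  int1 Z -> cond_exp_le P G (EFin \o X) (EFin \o Z) ->
  int1 X /\ 'E X <= 'E Z.
Proof.
move=> X0 iZ [Y [mX _ mY /(_ _ sub_sigma_setT) XY] YZ].
have {}mY : measurable_fun setT Y := measurable_wrtW mY.
have mZ : measurable_fun setT (EFin \o Z) by case/integrableP : iZ.
have XZ : (\int[P]_w (EFin \o X) w <= \int[P]_w (EFin \o Z) w)%E.
  (* [Y] is not yet known to be integrable, so positive and negative parts are compared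
     separately. *)
  rewrite -XY [leLHS]integralE [leRHS]integralE; apply: leeB.
    apply: ae_ge0_le_integral => //; try exact: measurable_funepos.
    move: YZ; apply: filterS => w YZ _; rewrite !funeposE.
    by rewrite ge_max !le_max YZ lexx orbT.
  apply: ae_ge0_le_integral => //; try exact: measurable_funeneg.
  move: YZ; apply: filterS => w YZ _; rewrite !funenegE.
  by rewrite ge_max !le_max leeN2 YZ lexx orbT.
have Zfin := integrable_fin_num measurableT iZ.
have iX : int1 X.
  apply/integrableP; split => //.
  under eq_integral do rewrite /= ger0_norm//.
  by apply: le_lt_trans XZ _; rewrite ltey_eq Zfin.
split => //; rewrite /Rintegral fine_le//.
exact: (integrable_fin_num measurableT iX).
Qed.

Variable n : nat.
Implicit Types X Y W : T -> 'rV[R]_n.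

Definition vmeasurable_wrt W := forall i, measurable_wrt G (fun w => W w 0 i).

Lemma vmeasurable_wrtW W : vmeasurable_wrt W ->
  forall i, measurable_fun setT (fun w => W w 0 i).
Proof. by move=> hW i; exact: measurable_wrtW. Qed.

Lemma vmeasurable_wrtB X Y : vmeasurable_wrt X -> vmeasurable_wrt Y ->
  vmeasurable_wrt (fun w => X w - Y w).
Proof.
move=> hX hY i; under [fun w => _]eq_fun do rewrite !mxE.
exact: (measurable_funB (hX i) (hY i)).
Qed.

Lemma vmeasurable_wrt_cst v : vmeasurable_wrt (fun=> v).
Proof. by move=> i; exact: measurable_cst. Qed.

(** [measurable_lipschitz] is applied with [g_sigma_algebraType G] as the underlying space. This
    makes [F (x k)] and the projection of [x k] measurable with respect to [Fil k]. *)
Lemma vmeasurable_wrt_lipschitz (f : 'rV[R]_n -> 'rV[R]_n) (L : R) X :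
  0 < L -> (forall x y, enorm (f x - f y) <= L * enorm (x - y)) ->
  vmeasurable_wrt X -> vmeasurable_wrt (fun w => f (X w)).
Proof.
move=> L0 lf hX i; apply: (measurable_lipschitz (f := fun x => f x 0 i) L0) => //.
move=> x y; apply: le_trans (lf x y).
by have := le_coord_enorm (f x - f y) i; rewrite !mxE.
Qed.

Lemma cond_exp_dotv_orthogonal X Y W :
  vsq_integrable P X -> vsq_integrable P Y -> vsq_integrable P W ->
  vmeasurable_wrt W ->
  (forall i, is_cond_exp P G (fun w => (X w 0 i)%:E) (fun w => (Y w 0 i)%:E)) ->
  'E (fun w => dotv (Y w - X w) (W w)) = 0.
Proof.
move=> hX hY hW mW XY.
have hYX := vsq_integrableB hY hX.
rewrite Esum; last by move=> i; exact: sq_integrableM (hYX i) (hW i).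
rewrite big1// => i _; apply: integral_mul_orthogonal => //.
- exact: sq_integrable_int1 (hYX i).
- move=> A GA; under eq_Rintegral do rewrite !mxE.
  exact: (cond_exp_residual (sq_integrable_int1 (hX i))
    (sq_integrable_int1 (hY i)) (XY i)).
- exact: sq_integrableM (hYX i) (hW i).
Qed.

End SubSigmaAlgebra.
End ConditionalExpectation.

(** * Lower integrals, compactness and rate constants *)

(* No measurability is needed: the integral of a nonnegative function is defined
   as a supremum over simple functions below it. The gap, a supremum over u, is
   not known to be measurable. *)
Lemma ge0_le_integral_nomeas (R : realType) (d : measure_display)
    (T : measurableType d) (mu : measure T R) (f g : T -> \bar R) :
  (forall w, 0 <= f w)%E -> (forall w, f w <= g w)%E ->
  (\int[mu]_w f w <= \int[mu]_w g w)%E.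
Proof.
move=> f0 fg.
have g0 w : (0 <= g w)%E := le_trans (f0 w) (fg w).
rewrite !ge0_integralTE//; apply: ereal_sup_le => _ [h hf <-].
by exists h => // w; exact: le_trans (hf w) (fg w).
Qed.

(** The real-valued [sup] dominates its set only when that set is bounded above; compactness bounds
    every coordinate and hence the squared distances. *)
Lemma compact_enorm_sup (R : realType) (n : nat) (S : set 'rV[R]_n) x0 u :
  compact S -> S u ->
  dotv (x0 - u) (x0 - u) <= sup [set enorm (x0 - v) ^+ 2 | v in S].
Proof.
move=> cS Su; rewrite -enorm_sqr; apply: ub_le_sup; last by exists u.
have [M [_ hM]] := compact_bounded cS.
exists (\sum_(i < n) (`|x0 0 i| + (M + 1)) ^+ 2) => _ [v Sv <-].
rewrite enorm_sqr; apply: ler_sum => i _; rewrite -expr2 !mxE.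
(* Boundedness provides a bound only for numbers strictly above [M], hence [M + 1]. *)
have vM : `|v| <= M + 1 by apply: hM => //; rewrite ltrDl.
have vi : `|v 0 i| <= M + 1.
  apply: le_trans vM; rewrite /Num.norm/= mx_normrE.
  exact: (le_bigmax _ (fun ij => `|v ij.1 ij.2|) (0, i)).
rewrite -real_normK ?num_real// ler_pXn2r// ?nnegrE//.
  by apply: le_trans (ler_normB _ _) _; rewrite lerD2l.
by rewrite addr_ge0// (le_trans _ vi).
Qed.

(* The H k are summed with the Lyapunov function V + (B / rho) gamma^2 S; adding
   (B / rho) S then makes the sum of the G k telescope as well. *)
Lemma descent_sum_bound (R : realType) (A B C D1 D2 rho gamma : R)
    (V H S G : nat -> R) (K : nat) :
  0 <= A -> 0 <= B -> 0 <= C -> 0 < rho -> 0 < gamma ->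
  2 * gamma * (A + B * C / rho) <= 1 ->
  (forall k, 0 <= V k) -> (forall k, 0 <= H k) -> (forall k, 0 <= S k) ->
  (forall k, G k <= 2 * A * H k + B * S k + D1) ->
  (forall k, S k.+1 <= 2 * C * H k + (1 - rho) * S k + D2) ->
  (forall k, V k.+1 <= V k - 2 * gamma * H k + gamma ^+ 2 * G k) ->
  let a := A + B * C / rho in let D := D1 + B * D2 / rho in
  \sum_(k < K) G k <=
    2 * a * (V 0%N / gamma + B / rho * gamma * S 0%N + K%:R * gamma * D)
    + B / rho * S 0%N + K%:R * D.
Proof.
move=> A0 B0 C0 rho0 g0 ga V0 H0 S0 hG hS hV; cbv zeta.
pose b := B / rho; have b0 : 0 <= b by rewrite divr_ge0// ltW.
have bB : b * rho = B by rewrite divfK ?gt_eqF.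
have -> : B * C / rho = b * C by rewrite mulrAC.
have -> : B * D2 / rho = b * D2 by rewrite mulrAC.
move: ga; have -> : B * C / rho = b * C by rewrite mulrAC.
rewrite -/b; set a := A + b * C; set D := D1 + b * D2 => ga.
have a0 : 0 <= a by rewrite addr_ge0// mulr_ge0.
(* Since [b * rho = B], the contraction factor produces exactly [- B * S k], which cancels the
   [B * S k] in the bound on [G k]. *)
have hbS k : b * S k.+1 <= 2 * (b * C) * H k + b * S k - B * S k + b * D2.
  by have := ler_wpM2l b0 (hS k); rewrite -bB; lra.
have sumG m : \sum_(k < m) G k + b * S m <=
    2 * a * \sum_(k < m) H k + b * S 0%N + m%:R * D.
  elim: m => [|m IH]; first by rewrite !big_ord0; lra.
  rewrite !big_ord_recr/= -natr1.
  by have := hG m; have := hbS m; rewrite /a /D in IH *; lra.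
have step k : V k.+1 + b * gamma ^+ 2 * S k.+1 <=
    V k + b * gamma ^+ 2 * S k - gamma * H k + gamma ^+ 2 * D.
  have g2 : 0 <= gamma ^+ 2 by rewrite sqr_ge0.
  have h1 := ler_wpM2l g2 (hG k); have h2 := ler_wpM2l g2 (hbS k).
  have h3 := hV k.
  (* The stepsize condition makes the [H k] contribution of the variance at most [gamma * H k], half
     of the descent term [2 * gamma * H k]. *)
  have h4 : gamma * H k * (2 * gamma * a) <= gamma * H k.
    by rewrite ler_piMr// mulr_ge0// ltW.
  by rewrite /a /D in h4 *; lra.
have sumH m : V m + b * gamma ^+ 2 * S m + gamma * \sum_(k < m) H k <=
    V 0%N + b * gamma ^+ 2 * S 0%N + m%:R * (gamma ^+ 2 * D).
  elim: m => [|m IH]; first by rewrite !big_ord0; lra.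
  by rewrite big_ord_recr/= -natr1; have := step m; lra.
have hH : \sum_(k < K) H k <=
    V 0%N / gamma + b * gamma * S 0%N + K%:R * gamma * D.
  rewrite -(ler_pM2l g0).
  have -> : gamma * (V 0%N / gamma + b * gamma * S 0%N + K%:R * gamma * D) =
      V 0%N + b * gamma ^+ 2 * S 0%N + K%:R * (gamma ^+ 2 * D).
    by field; rewrite gt_eqF.
  have := sumH K; have := V0 K.
  have : 0 <= b * gamma ^+ 2 * S K by rewrite mulr_ge0// mulr_ge0// sqr_ge0.
  lra.
have a20 : 0 <= 2 * a by rewrite mulr_ge0.
have := ler_wpM2l a20 hH; have := sumG K.
have : 0 <= b * S K by rewrite mulr_ge0.
lra.
Qed.

(** The rest is bookkeeping with slack: dividing by [2 gamma K] turns the coefficient [5 / 2] into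
    [5 / 4], and then [6 a <= c], [5 / 4 <= 3] and [D <= D1 + 2 B D2 / rho] suffice. *)
Lemma rate_bound (R : realType) (A B C D1 D2 rho gamma ell M V0 s2 E : R)
    (K : nat) :
  0 <= A -> 0 <= B -> 0 <= C -> 0 <= D1 -> 0 <= D2 -> 0 < rho -> 0 < gamma ->
  0 <= ell -> 0 <= V0 -> 0 <= s2 -> (0 < K)%N ->
  let a := A + B * C / rho in let D := D1 + B * D2 / rho in
  let c := 6 * A + 3 * ell + 12 * B * C / rho in
  E <= 2 * a * (V0 / gamma + B / rho * gamma * s2 + K%:R * gamma * D)
    + B / rho * s2 + K%:R * D ->
  (2 * gamma * K%:R)^-1 * (3 * M + 5 / 2 * gamma ^+ 2 * E) <=
  3 * M / (2 * gamma * K%:R) + c * (V0 / K%:R)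
  + (6 + c * gamma) * (gamma * B * s2 / (rho * K%:R))
  + gamma * (3 + gamma * c) * (D1 + 2 * B * D2 / rho).
Proof.
move=> A0 B0 C0 D10 D20 rho0 g0 l0 V00 s20 K0; cbv zeta.
have K0' : 0 < K%:R :> R by rewrite ltr0n.
pose b := B / rho; have b0 : 0 <= b by rewrite divr_ge0// ltW.
have -> : B * C / rho = b * C by rewrite mulrAC.
have -> : 12 * B * C / rho = 12 * (b * C) by rewrite /b; ring.
have -> : B * D2 / rho = b * D2 by rewrite mulrAC.
have -> : 2 * B * D2 / rho = 2 * (b * D2) by rewrite /b; ring.
rewrite -/b => hE.
set c := 6 * A + 3 * ell + 12 * (b * C).
set a := A + b * C in hE; set D := D1 + b * D2 in hE.
have bC0 : 0 <= b * C by rewrite mulr_ge0.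
have bD0 : 0 <= b * D2 by rewrite mulr_ge0.
have a0 : 0 <= a by rewrite addr_ge0.
have D0 : 0 <= D by rewrite addr_ge0.
have ca : 6 * a <= c by rewrite /a /c; lra.
pose v := V0 / K%:R; pose s := gamma * (b * s2) / K%:R.
have v0 : 0 <= v by rewrite divr_ge0// ltW.
have s0 : 0 <= s.
  by apply: divr_ge0 (ltW K0'); exact: mulr_ge0 (ltW g0) (mulr_ge0 b0 s20).
have -> : gamma * B * s2 / (rho * K%:R) = s.
  by rewrite /s /b; field; rewrite !gt_eqF.
apply: le_trans (_ : 3 * M / (2 * gamma * K%:R) + 5 / 4 * (2 * a * (v + gamma * s
    + gamma ^+ 2 * D) + s + gamma * D) <= _).
  rewrite mulrC ler_pdivrMr ?mulr_gt0//.
  have g2 : 0 <= 5 / 2 * gamma ^+ 2 by rewrite mulr_ge0 ?sqr_ge0//; lra.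
  have := ler_wpM2l g2 hE.
  have -> : (3 * M / (2 * gamma * K%:R) + 5 / 4 * (2 * a * (v + gamma * s
    + gamma ^+ 2 * D) + s + gamma * D)) * (2 * gamma * K%:R) = 3 * M +
      5 / 2 * gamma ^+ 2 * (2 * a * (V0 / gamma + b * gamma * s2
        + K%:R * gamma * D) + b * s2 + K%:R * D).
    by rewrite /v /s; field; rewrite !gt_eqF.
  lra.
have gs0 : 0 <= gamma * s by rewrite mulr_ge0// ltW.
have gD0 : 0 <= gamma * D by rewrite mulr_ge0// ltW.
have ggD0 : 0 <= gamma ^+ 2 * D by rewrite mulr_ge0// sqr_ge0.
have t1 := ler_wpM2r v0 ca; have t2 := ler_wpM2r gs0 ca.
have t3 := ler_wpM2r ggD0 ca.
have av : 0 <= a * v by rewrite mulr_ge0.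
have ags : 0 <= a * (gamma * s) by rewrite mulr_ge0.
have aggD : 0 <= a * (gamma ^+ 2 * D) by rewrite mulr_ge0.
have c0 : 0 <= c by rewrite (le_trans _ ca)// mulr_ge0.
have t4 : gamma * (3 + gamma * c) * D <=
    gamma * (3 + gamma * c) * (D1 + 2 * (b * D2)).
  rewrite ler_wpM2l//; last by rewrite /D; lra.
  by apply: mulr_ge0 (ltW g0) _; have := mulr_ge0 (ltW g0) c0; lra.
apply: le_trans (lerD (lexx _) t4).
rewrite -/v; clearbody v s D a c; rewrite expr2 in t3 ggD0 aggD *; lra.
Qed.

(** * Gap along a trajectory *)

Section Iterates.
Variables (R : realType) (n : nat).
Variables (F : 'rV[R]_n -> 'rV[R]_n) (r : 'rV[R]_n -> \bar R).
Hypotheses (r_proper : eproper r) (r_convex : econvex r).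
Variable proj : 'rV[R]_n -> 'rV[R]_n.
Hypothesis projP : forall y, is_proj (vi_sol F r) y (proj y).
Variables (ell : R) (ell_gt0 : 0 < ell) (F_coco : cocoercive ell F).

Lemma proj_sol y : vi_sol F r (proj y). Proof. by case: (projP y). Qed.

Lemma F_proj y z : F (proj y) = F (proj z).
Proof.
exact: (vi_sol_F_const r_proper ell_gt0 F_coco (proj_sol y) (proj_sol z)).
Qed.

Lemma proj_lipschitz x y : enorm (proj x - proj y) <= 1 * enorm (x - y).
Proof.
rewrite mul1r; apply: (@proj_nonexpansive _ _ (vi_sol F r)) => // u v t hu hv.
exact: (vi_sol_convex r_proper r_convex ell_gt0 F_coco hu hv).
Qed.

Section Gap.
Variables (gamma : R) (x g : nat -> 'rV[R]_n).
Hypotheses (gamma_gt0 : 0 < gamma) (gamma_ell : gamma * ell <= 1).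
Hypothesis hprox : forall k, is_prox gamma r (x k - gamma *: g k) (x k.+1).

Let e k := F (x k) - g k.

Lemma sum_step_gap u K : r u \is a fin_num ->
  2 * gamma * (dotv (F u) (\sum_(1 <= k < K.+1) x k - K%:R *: u)
    + \sum_(1 <= k < K.+1) fine (r (x k)) - K%:R * fine (r u)) <=
  dotv (x 0%N - u) (x 0%N - u) - dotv (x K - u) (x K - u)
  + 2 * gamma * \sum_(k < K) dotv (e k) (x k - u)
  + 2 * gamma ^+ 2 * \sum_(k < K) dotv (e k) (e k).
Proof.
move=> ru; elim: K => [|K IH].
  by rewrite !big_geq// !big_ord0 scale0r subrr dotv0r; lra.
rewrite !(@big_nat_recr _ _ _ K.+1)//= !big_ord_recr/= -(natr1 K).
have -> : \sum_(1 <= k < K.+1) x k + x K.+1 - (K%:R + 1) *: u =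
    (\sum_(1 <= k < K.+1) x k - K%:R *: u) + (x K.+1 - u).
  by rewrite scalerDl scale1r opprD addrACA.
rewrite (dotvDr _ _ (F u)).
have := prox_step_gap r_proper r_convex ell_gt0 F_coco gamma_gt0 (hprox K)
  gamma_ell ru.
rewrite -/(e K); lra.
Qed.

(** The right-hand side is free of [u], so it bounds the supremum. The factor 3 of [M] is one
    [|x^0 - u|^2] from telescoping plus two from separating [u] from the noise. *)
Lemma gap_avg_le (S : set 'rV[R]_n) K : compact S -> (0 < K)%N ->
  let M := sup [set enorm (x 0%N - u) ^+ 2 | u in S] in
  (gap F r S (K%:R^-1 *: \sum_(1 <= k < K.+1) x k) <=
   ((2 * gamma * K%:R)^-1 * (3 * M
     + 2 * gamma * \sum_(k < K) dotv (e k) (x k - x 0%N)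
     + gamma ^+ 2 / 2 * dotv (\sum_(k < K) e k) (\sum_(k < K) e k)
     + 2 * gamma ^+ 2 * \sum_(k < K) dotv (e k) (e k)))%:E)%E.
Proof.
move=> cS K0; cbv zeta.
have K0' : 0 < K%:R :> R by rewrite ltr0n.
have rx k : r (x k.+1) \is a fin_num := is_prox_fin_num r_proper (hprox k).
have [rz zle] := jensen_avg r_proper r_convex K0 rx.
set z := _ *: _ in rz zle *.
have zE : \sum_(1 <= k < K.+1) x k = K%:R *: z.
  by rewrite /z scalerA mulfV ?gt_eqF// scale1r.
apply: ge_ereal_sup => _ [u Su <-].
(* A point with [r u = +oo] contributes [-oo], as [r] is finite at the average. *)
have [ru|] := boolP (r u \is a fin_num); last first.
  case: (r u) (r_proper.1 u) => //= _ _.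
  by rewrite -(fineK rz) /= leNye.
rewrite -(fineK rz) -(fineK ru) -!EFinD lee_fin.
rewrite mulrC ler_pdivlMr ?mulr_gt0//.
have := sum_step_gap K ru; rewrite zE -scalerBr dotvZr.
have Msup := compact_enorm_sup (x 0%N) cS Su.
set M := sup _ in Msup *.
have -> : \sum_(k < K) dotv (e k) (x k - u) =
    \sum_(k < K) dotv (e k) (x k - x 0%N) + dotv (\sum_(k < K) e k) (x 0%N - u).
  rewrite dotv_suml -big_split/=; apply: eq_bigr => k _.
  by rewrite -dotvDr addrA subrK.
have := dotv_ge0 (x K - u).
(* Twice this square is the Young inequality [2 gamma <E, y> <= 2 |y|^2 + (gamma^2 / 2) |E|^2]. *)
have := dotv_ge0 ((gamma / 2) *: (\sum_(k < K) e k) - (x 0%N - u)).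
set E := \sum_(k < K) e k; set y := x 0%N - u in Msup *.
clearbody E y; rewrite !dotvE (dotvC y E) -/z.
have zle' : 2 * gamma * (K%:R * fine (r z)) <=
    2 * gamma * (\sum_(1 <= k < K.+1) fine (r (x k))).
  by rewrite ler_pM2l ?mulr_gt0.
lra.
Qed.

(** The solution [proj z] lies in [S], and its own variational inequality tested at [z] is the
    corresponding term of the supremum. *)
Lemma gap_ge0 (S : set 'rV[R]_n) z : vi_sol F r `<=` S -> (0 <= gap F r S z)%E.
Proof.
move=> hS; apply: le_trans (proj_sol z z) _.
by apply: ereal_sup_ubound; exists (proj z) => //; exact/hS/proj_sol.
Qed.

End Gap.
End Iterates.

(** * Expectations *)

Section Moments.
Variables (R : realType) (n : nat).
Variables (F : 'rV[R]_n -> 'rV[R]_n) (r : 'rV[R]_n -> \bar R).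
Hypotheses (r_proper : eproper r) (r_convex : econvex r).
Variable proj : 'rV[R]_n -> 'rV[R]_n.
Hypothesis projP : forall y, is_proj (vi_sol F r) y (proj y).
Variables (ell : R) (ell_gt0 : 0 < ell) (F_coco : cocoercive ell F).
Variables (d : measure_display) (T : measurableType d) (P : probability T R).
Variables (Fil : nat -> set (set T)) (hFil : filtration Fil).
Variables (gamma : R) (x0 : 'rV[R]_n) (x g : nat -> T -> 'rV[R]_n).
Hypotheses (gamma_gt0 : 0 < gamma) (hsgda : sgda Fil gamma r x0 x g).
Variable sigma : nat -> T -> R.
Variables (sigma0 : R) (hsigma0 : forall w, sigma 0%N w = sigma0).
Variables (A B C D1 D2 rho : R).
Hypothesis hkey : key_assumption P Fil F proj x g sigma A B C D1 D2 rho.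

Local Notation int1 f := (P.-integrable setT (EFin \o f)).
Local Notation "''E' f" := (\int[P]_w f w) (at level 10, f at level 8).

Let q := F (proj x0).
Let e k w := F (x k w) - g k w.
Let xs k w := proj (x k w).
Let h k w := dotv (F (x k w) - q) (x k w - xs k w).

Let FilS k : sigma_algebra setT (Fil k). Proof. by case: hFil. Qed.
Let FilM k : Fil k `<=` measurable. Proof. by case: hFil => _ /(_ k). Qed.

Let Fil_mono j k : (j <= k)%N -> Fil j `<=` Fil k.
Proof.
move=> /subnKC <-; elim: (k - j)%N => [|m IH]; first by rewrite addn0.
by apply: subset_trans IH _; rewrite addnS; case: hFil => _ _; apply.
Qed.

Let vmeas_mono j k (X : T -> 'rV[R]_n) : (j <= k)%N ->
  vmeasurable_wrt (Fil j) X -> vmeasurable_wrt (Fil k) X.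
Proof.
move=> jk mX i; apply/(measurable_wrtP (FilS k)) => Y mY.
exact: (Fil_mono jk ((measurable_wrtP (FilS j) _).1 (mX i) _ mY)).
Qed.

Let mx k : vmeasurable_wrt (Fil k) (x k).
Proof. by case: hsgda => _ _ + _ i; apply. Qed.

Let mFx k : vmeasurable_wrt (Fil k) (fun w => F (x k w)).
Proof.
exact: (vmeasurable_wrt_lipschitz ell_gt0
  (cocoercive_lipschitz ell_gt0 F_coco) (@mx k)).
Qed.

Let mxs k : vmeasurable_wrt (Fil k) (xs k).
Proof.
exact: (vmeasurable_wrt_lipschitz ltr01
  (proj_lipschitz r_proper r_convex projP ell_gt0 F_coco) (@mx k)).
Qed.

Let mg k : vmeasurable_wrt (Fil k.+1) (g k).
Proof. by case: hsgda => _ _ _ + i; apply. Qed.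

Let me k : vmeasurable_wrt (Fil k.+1) (e k).
Proof. by apply: vmeasurable_wrtB (@mg k); exact: vmeas_mono (@mFx k). Qed.

Let hprox k w : is_prox gamma r (x k w - gamma *: g k w) (x k.+1 w).
Proof. by case: hsgda. Qed.

Let Fxs k w : F (xs k w) = q.
Proof. exact (F_proj r_proper projP ell_gt0 F_coco _ _). Qed.

(** The difference [f (X w) - f x0] is dominated by [L |X w - x0|]; adding back the constant [f x0]
    is harmless under a probability. *)
Lemma vsq_integrable_lipschitz (f : 'rV[R]_n -> 'rV[R]_n) (L : R)
    (X : T -> 'rV[R]_n) : 0 < L ->
  (forall y z, enorm (f y - f z) <= L * enorm (y - z)) ->
  vsq_integrable P X -> vsq_integrable P (fun w => f (X w)).
Proof.
move=> L0 lf hX.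
have mfX i : measurable_fun setT (fun w => (f (X w) - f x0) 0 i).
  apply: (measurable_lipschitz (f := fun y => (f y - f x0) 0 i) L0) => [y z|j].
    apply: le_trans (lf y z); apply: le_trans (le_coord_enorm _ i).
    by rewrite !mxE opprB addrA subrK.
  by case: (hX j).
have hX0 := vsq_integrableB hX (vsq_integrable_cst P x0).
have hle w : dotv (f (X w) - f x0) (f (X w) - f x0) <=
    L ^+ 2 * dotv (X w - x0) (X w - x0).
  by rewrite -le_enormZ// ltW.
have hd := vsq_integrable_dom mfX hle (int1Z _ (int1_dotv hX0 hX0)).
have := vsq_integrableD hd (vsq_integrable_cst P (f x0)).
by under [fun w => _]eq_fun do rewrite subrK.
Qed.

Let moments k := vsq_integrable P (x k) /\ int1 (fun w => sigma k w ^+ 2).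

Let vF k : moments k -> vsq_integrable P (fun w => F (x k w)).
Proof.
move=> [hx _].
exact: vsq_integrable_lipschitz (cocoercive_lipschitz ell_gt0 F_coco) hx.
Qed.

Let vxs k : moments k -> vsq_integrable P (xs k).
Proof.
move=> [hx _]; exact: (vsq_integrable_lipschitz ltr01
  (proj_lipschitz r_proper r_convex projP ell_gt0 F_coco) hx).
Qed.

Let vFq k : moments k -> vsq_integrable P (fun w => F (x k w) - q).
Proof. by move=> /vF hk; exact: vsq_integrableB hk (vsq_integrable_cst P q). Qed.

Let vxxs k : moments k -> vsq_integrable P (fun w => x k w - xs k w).
Proof. by move=> hk; exact: vsq_integrableB hk.1 (vxs hk). Qed.

Let int1_h k : moments k -> int1 (h k).
Proof. by move=> hk; exact: int1_dotv (vFq hk) (vxxs hk). Qed.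

Let variance_bound k : moments k ->
  int1 (fun w => dotv (g k w - q) (g k w - q)) /\
  'E (fun w => dotv (g k w - q) (g k w - q)) <=
    2 * A * 'E (h k) + B * 'E (fun w => sigma k w ^+ 2) + D1.
Proof.
move=> hk; have [_ _ _ /(_ k) + _] := hkey.
under [X in cond_exp_le _ _ X _]eq_fun do rewrite enorm_sqr Fxs.
under [X in cond_exp_le _ _ _ X]eq_fun do rewrite Fxs -/(h k _).
have ih := int1Z (2 * A) (int1_h hk); have is2 := int1Z B hk.2.
have iZ := int1D (int1D ih is2) (int1_cst P D1).
move=> /(cond_exp_le_expectation (FilS k) (FilM (k:=k)) _ iZ)[w|iG le].
  exact: dotv_ge0.
split=> //; apply: le_trans le _.
rewrite ED ?ED ?EZ ?Ecst//; [exact: hk.2|exact: int1_h|exact: int1D|exact: int1_cst].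
Qed.

Let sigma_bound k : moments k ->
  int1 (fun w => sigma k.+1 w ^+ 2) /\
  'E (fun w => sigma k.+1 w ^+ 2) <=
    2 * C * 'E (h k) + (1 - rho) * 'E (fun w => sigma k w ^+ 2) + D2.
Proof.
move=> hk; have [_ _ _ _ /(_ k)] := hkey.
under [X in cond_exp_le _ _ _ X]eq_fun do rewrite Fxs -/(h k _).
have ih := int1Z (2 * C) (int1_h hk); have is2 := int1Z (1 - rho) hk.2.
have iZ := int1D (int1D ih is2) (int1_cst P D2).
move=> /(cond_exp_le_expectation (FilS k) (FilM (k:=k)) _ iZ)[w|iG le].
  exact: sqr_ge0.
split=> //; apply: le_trans le _.
rewrite ED ?ED ?EZ ?Ecst//; [exact: hk.2|exact: int1_h|exact: int1D|exact: int1_cst].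
Qed.

Let vgq k : moments k -> vsq_integrable P (fun w => g k w - q).
Proof.
move=> /variance_bound[iG _]; apply: (vsq_integrable_dom _ _ iG) => // i.
apply: (vmeasurable_wrtW (FilS k.+1) (FilM (k:=k.+1))).
by apply: vmeasurable_wrtB (@mg k) _; exact: vmeasurable_wrt_cst.
Qed.

Let vg k : moments k -> vsq_integrable P (g k).
Proof.
move=> /vgq hk; have := vsq_integrableD hk (vsq_integrable_cst P q).
by under [fun w => _]eq_fun do rewrite subrK.
Qed.

(** Second moments are derived, by induction. The key assumption controls [g k - q] and
    [sigma k.+1], and contraction towards the fixed solution [proj x0], where [F] equals [q],
    controls [x k.+1]. *)
Lemma momentsP k : moments k.
Proof.
elim: k => [|k hk].
  split.
    by case: hsgda => hx0 _ _ _; rewrite (funext hx0); exact: vsq_integrable_cst.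
  by rewrite (funext hsigma0); exact: int1_cst.
split; last by case: (sigma_bound hk).
pose xs0 := proj x0.
have v1 := vsq_integrableB (vsq_integrableB hk.1 (vsq_integrable_cst P xs0))
  (vsq_integrableZ gamma (vgq hk)).
have hd : vsq_integrable P (fun w => x k.+1 w - xs0).
  apply: (vsq_integrable_dom _ _ (int1_dotv v1 v1)) => [i|w].
    apply: (vmeasurable_wrtW (FilS k.+1) (FilM (k:=k.+1))).
    by apply: vmeasurable_wrtB (@mx k.+1) _; exact: vmeasurable_wrt_cst.
  exact: (prox_step_contract r_proper r_convex gamma_gt0 (hprox k w) (proj_sol projP x0)).
have := vsq_integrableD hd (vsq_integrable_cst P xs0).
by under [fun w => _]eq_fun do rewrite subrK.
Qed.

Let ve k : vsq_integrable P (e k).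
Proof. by have hk := momentsP k; exact: vsq_integrableB (vF hk) (vg hk). Qed.

Let e_orthogonal k W : vmeasurable_wrt (Fil k) W -> vsq_integrable P W ->
  'E (fun w => dotv (e k w) (W w)) = 0.
Proof.
move=> mW hW; have hk := momentsP k.
apply: (cond_exp_dotv_orthogonal (FilS k) (FilM (k:=k)) (vg hk) (vF hk) hW mW).
by case: hkey => _ _ + _ _ i; apply.
Qed.

(** Bias-variance decomposition: [g k - q = (F (x k) - q) - e k], and the cross term vanishes
    because [F (x k) - q] is known before iteration [k]. *)
Let variance_le k : 'E (fun w => dotv (e k w) (e k w)) <=
  'E (fun w => dotv (g k w - q) (g k w - q)).
Proof.
have hk := momentsP k.
have mFq : vmeasurable_wrt (Fil k) (fun w => F (x k w) - q).
  by apply: vmeasurable_wrtB (@mFx k) _; exact: vmeasurable_wrt_cst.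
have o := e_orthogonal mFq (vFq hk).
have i1 := int1_dotv (@ve k) (@ve k).
have i2 := int1_dotv (@ve k) (vFq hk).
have i3 := int1_dotv (vFq hk) (vFq hk).
have -> : 'E (fun w => dotv (g k w - q) (g k w - q)) =
   'E (fun w => dotv (e k w) (e k w) - 2 * dotv (e k w) (F (x k w) - q)
      + dotv (F (x k w) - q) (F (x k w) - q)).
  apply: eq_Rintegral => w _.
  have -> : g k w - q = (F (x k w) - q) - e k w.
    by apply/rowP => i; rewrite !mxE; ring.
  by move: (F (x k w) - q) (e k w) => a b; rewrite !dotvE (dotvC b a); ring.
rewrite ED ?EB ?EZ// ?o ?mulr0 ?subr0 ?lerDl.
- by apply: Rintegral_ge0 => w _; exact: dotv_ge0.
- exact: int1Z.
- by apply: int1B => //; exact: int1Z.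
Qed.

Let sum_e_variance K :
  'E (fun w => dotv (\sum_(k < K) e k w) (\sum_(k < K) e k w)) =
  \sum_(k < K) 'E (fun w => dotv (e k w) (e k w)).
Proof.
elim: K => [|K IH].
  by under eq_Rintegral do rewrite big_ord0 dotv0l; rewrite big_ord0 Ecst.
rewrite big_ord_recr/= -IH.
pose S w := \sum_(k < K) e k w.
have vS : vsq_integrable P S by apply: vsq_integrable_sum => i; exact: ve.
(* Each [e k] with [k < K] is [Fil k.+1]-measurable, hence [Fil K]-measurable, so the partial sum is
   orthogonal to [e K]. *)
have mS : vmeasurable_wrt (Fil K) S.
  move=> i; rewrite /S; under [fun w => _]eq_fun do rewrite summxE.
  by apply: measurable_sum => k; exact: vmeas_mono (@me k) i.
under eq_Rintegral => w _.
  have -> : dotv (\sum_(k < K.+1) e k w) (\sum_(k < K.+1) e k w) =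
    dotv (S w) (S w) + 2 * dotv (e K w) (S w) + dotv (e K w) (e K w).
    rewrite big_ord_recr/= -/(S w); move: (S w) (e K w) => a b.
    by rewrite !dotvE (dotvC b a); ring.
  over.
have i1 := int1_dotv vS vS; have i2 := int1_dotv (@ve K) vS.
rewrite ED ?ED ?EZ ?(e_orthogonal mS vS) ?mulr0 ?addr0//.
- exact: int1Z.
- by apply: int1D => //; exact: int1Z.
- exact: int1_dotv.
Qed.

Let cross_term k : 'E (fun w => dotv (e k w) (x k w - x0)) = 0.
Proof.
have hk := momentsP k.
apply: e_orthogonal.
  by apply: vmeasurable_wrtB (@mx k) _; exact: vmeasurable_wrt_cst.
exact: vsq_integrableB hk.1 (vsq_integrable_cst P x0).
Qed.

Let distance_descent k :
  'E (fun w => dotv (x k.+1 w - xs k.+1 w) (x k.+1 w - xs k.+1 w)) <=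
  'E (fun w => dotv (x k w - xs k w) (x k w - xs k w)) - 2 * gamma * 'E (h k)
  + gamma ^+ 2 * 'E (fun w => dotv (g k w - q) (g k w - q)).
Proof.
have hk := momentsP k; have hk1 := momentsP k.+1.
have ix := int1_dotv (vxxs hk) (vxxs hk).
have ix1 := int1_dotv (vxxs hk1) (vxxs hk1).
have ig := int1_dotv (vgq hk) (vgq hk).
have ie := int1_dotv (@ve k) (vxxs hk).
have ih := int1_h hk.
have mxxs : vmeasurable_wrt (Fil k) (fun w => x k w - xs k w).
  exact: vmeasurable_wrtB (@mx k) (@mxs k).
have o := e_orthogonal mxxs (vxxs hk).
have i12 := int1B ix (int1Z (2 * gamma) ih).
have i123 := int1D i12 (int1Z (gamma ^+ 2) ig).
have -> : 'E (fun w => dotv (x k w - xs k w) (x k w - xs k w)) - 2 * gamma * 'E (h k)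
   + gamma ^+ 2 * 'E (fun w => dotv (g k w - q) (g k w - q)) =
   'E (fun w => dotv (x k w - xs k w) (x k w - xs k w) - 2 * gamma * h k w
     + gamma ^+ 2 * dotv (g k w - q) (g k w - q)
     + 2 * gamma * dotv (e k w) (x k w - xs k w)).
  rewrite (ED i123 (int1Z (2 * gamma) ie)) (ED i12 (int1Z (gamma ^+ 2) ig)).
  by rewrite (EB ix (int1Z (2 * gamma) ih)) !EZ// o mulr0 addr0.
apply: Ele ix1 (int1D i123 (int1Z (2 * gamma) ie)) _ => w.
(* The projection of the new iterate is at least as close to it as the old projection [xs k w], so
   the contraction can be used at [xs k w]. *)
apply: le_trans (_ : dotv (x k.+1 w - xs k w) (x k.+1 w - xs k w) <= _).
  rewrite -le_enorm; have [_ /(_ _ (proj_sol projP (x k w)))] := projP (x k.+1 w).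
  by rewrite lee_fin !(enorm_sub (x k.+1 w)).
have := prox_step_contract r_proper r_convex gamma_gt0 (hprox k w)
  (proj_sol projP (x k w)).
rewrite -/(xs k w) Fxs => /le_trans; apply.
rewrite /h /e.
have -> : F (x k w) - q = (g k w - q) + (F (x k w) - g k w).
  by apply/rowP => i; rewrite !mxE; ring.
move: (x k w - xs k w) (g k w - q) (F (x k w) - g k w) => a b c.
by rewrite !dotvE (dotvC a b); lra.
Qed.


Section Bound.
Variable K : nat.
Hypotheses (K_gt0 : (0 < K)%N) (A0 : 0 <= A) (B0 : 0 <= B) (C0 : 0 <= C).
Hypotheses (rho_gt0 : 0 < rho) (gamma_le : 2 * gamma * (A + B * C / rho) <= 1).

Lemma sum_variance_le :
  let a := A + B * C / rho in let D := D1 + B * D2 / rho in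
  \sum_(k < K) 'E (fun w => dotv (F (x k w) - g k w) (F (x k w) - g k w)) <=
    2 * a * (enorm (x0 - proj x0) ^+ 2 / gamma + B / rho * gamma * sigma0 ^+ 2
      + K%:R * gamma * D) + B / rho * sigma0 ^+ 2 + K%:R * D.
Proof.
cbv zeta.
pose V k := 'E (fun w => dotv (x k w - xs k w) (x k w - xs k w)).
pose S k := 'E (fun w => sigma k w ^+ 2).
pose G k := 'E (fun w => dotv (g k w - q) (g k w - q)).
apply: le_trans (_ : \sum_(k < K) G k <= _).
  by apply: ler_sum => k _; exact: variance_le.
have V0E : V 0%N = enorm (x0 - proj x0) ^+ 2.
  rewrite enorm_sqr -[RHS](Ecst P); apply: eq_Rintegral => w _.
  by rewrite /xs; case: hsgda => -> _ _ _.
have S0E : S 0%N = sigma0 ^+ 2.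
  by rewrite -[RHS](Ecst P); apply: eq_Rintegral => w _; rewrite hsigma0.
rewrite -V0E -S0E; apply: (descent_sum_bound (H := fun k => 'E (h k))) => // k.
- by apply: Rintegral_ge0 => w _; exact: dotv_ge0.
- apply: Rintegral_ge0 => w _; rewrite /h -(Fxs k w).
  exact: cocoercive_monotone ell_gt0 F_coco _ _.
- by apply: Rintegral_ge0 => w _; exact: sqr_ge0.
- by case: (variance_bound (momentsP k)).
- by case: (sigma_bound (momentsP k)).
Qed.

(** The cross terms have mean zero and the squared sum has the mean of the sum of squares, so the
    two noise coefficients add up: [1 / 2 + 2 = 5 / 2]. *)
Lemma expectation_gap_bound (M : R) :
  let e k w := F (x k w) - g k w in
  let Y w := (2 * gamma * K%:R)^-1 * (3 * M
     + 2 * gamma * \sum_(k < K) dotv (e k w) (x k w - x 0%N w)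
     + gamma ^+ 2 / 2 * dotv (\sum_(k < K) e k w) (\sum_(k < K) e k w)
     + 2 * gamma ^+ 2 * \sum_(k < K) dotv (e k w) (e k w)) in
  int1 Y /\
  'E Y = (2 * gamma * K%:R)^-1 * (3 * M + 5 / 2 * gamma ^+ 2 *
    \sum_(k < K) 'E (fun w => dotv (e k w) (e k w))).
Proof.
cbv zeta; have x0E w : x 0%N w = x0 by case: hsgda.
under [X in int1 X]eq_fun do under eq_bigr do rewrite x0E.
under eq_Rintegral do under eq_bigr do rewrite x0E.
pose Se w := \sum_(k < K) e k w.
have vSe : vsq_integrable P Se by apply: vsq_integrable_sum => i; exact: ve.
have i1 := int1_cst P (3 * M).
have i2' k : int1 (fun w => dotv (e k w) (x k w - x0)).
  apply: int1_dotv; first exact: ve.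
  exact: vsq_integrableB (momentsP k).1 (vsq_integrable_cst P x0).
have i2 : int1 (fun w => \sum_(k < K) dotv (e k w) (x k w - x0)).
  by apply: int1_sum => k _.
have i3 := int1_dotv vSe vSe.
have i4' k : int1 (fun w => dotv (e k w) (e k w)) := int1_dotv (@ve k) (@ve k).
have i4 : int1 (fun w => \sum_(k < K) dotv (e k w) (e k w)).
  by apply: int1_sum => k _.
have i12 := int1D i1 (int1Z (2 * gamma) i2).
have i123 := int1D i12 (int1Z (gamma ^+ 2 / 2) i3).
have i1234 := int1D i123 (int1Z (2 * gamma ^+ 2) i4).
split; first exact: int1Z i1234.
rewrite (EZ _ i1234) (ED i123 (int1Z _ i4)) (ED i12 (int1Z _ i3)).
rewrite (ED i1 (int1Z _ i2)) Ecst !EZ// sum_e_variance !Esum//.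
rewrite (eq_bigr (fun=> 0)) => [|k _]; last exact: cross_term.
by rewrite big1//; congr (_ * _); lra.
Qed.

End Bound.

End Moments.

Theorem theorem2p6 (R : realType) (n : nat)
    (F : 'rV[R]_n -> 'rV[R]_n) (r : 'rV[R]_n -> \bar R)
    (hr_proper : eproper r) (hr_lsc : lower_semicontinuous r)
    (hr_convex : econvex r)
    (hsol : vi_sol F r !=set0)
    (proj : 'rV[R]_n -> 'rV[R]_n)
    (hproj : forall y, is_proj (vi_sol F r) y (proj y))
    (ell : R) (hell : 0 < ell) (hF : cocoercive ell F)
    (d : measure_display) (T : measurableType d) (P : probability T R)
    (Fil : nat -> set (set T)) (hFil : filtration Fil)
    (gamma : R) (x0 : 'rV[R]_n) (x g : nat -> T -> 'rV[R]_n)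
    (hsgda : sgda Fil gamma r x0 x g)
    (sigma0 : R) (sigma : nat -> T -> R)
    (hsigma0 : forall w, sigma 0%N w = sigma0)
    (A B C D1 D2 rho : R)
    (hA : 0 <= A) (hB : 0 <= B) (hC : 0 <= C) (hD1 : 0 <= D1) (hD2 : 0 <= D2)
    (hrho : 0 < rho <= 1)
    (hkey : key_assumption P Fil F proj x g sigma A B C D1 D2 rho)
    (S : set 'rV[R]_n) (hS_compact : compact S) (hS_convex : convex_set S)
    (hS_sol : vi_sol F r `<=` S)
    (hgamma0 : 0 < gamma)
    (* the extended-real inverse makes the second bound +oo when
       A + B * C / rho = 0 *)
    (hgamma : (gamma%:E <= Order.min (ell%:E^-1)
                             ((2 * (A + B * C / rho))%R%:E^-1))%E)
    (K : nat) (hK : (1 <= K)%N) :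
  let c := 6 * A + 3 * ell + 12 * B * C / rho in
  (\int[P]_w gap F r S (K%:R^-1 *: \sum_(1 <= k < K.+1) x k w)%R <=
   (3 * sup [set enorm (x0 - u) ^+ 2 | u in S] / (2 * gamma * K%:R)
    + c * (enorm (x0 - proj x0) ^+ 2 / K%:R)
    + (6 + c * gamma) * (gamma * B * sigma0 ^+ 2 / (rho * K%:R))
    + gamma * (3 + gamma * c) * (D1 + 2 * B * D2 / rho))%R%:E)%E.
Proof.
cbv zeta; have /andP[rho0 _] := hrho.
have a0 : 0 <= A + B * C / rho by rewrite addr_ge0// divr_ge0 ?mulr_ge0// ltW.
move: hgamma; rewrite le_min => /andP[h1 h2].
have gell : gamma * ell <= 1.
  move: h1; rewrite inver gt_eqF// lee_fin => h1.
  by rewrite -ler_pdivlMr// mul1r.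
have ga : 2 * gamma * (A + B * C / rho) <= 1.
  (* When the denominator is zero its extended inverse is [+oo] and [h2] carries no information, but
     the product to be bounded is then zero. *)
  move: h2; rewrite inver; case: eqVneq => [E _|nz].
    have -> : A + B * C / rho = 0 by lra.
    by rewrite mulr0.
  rewrite lee_fin -[X in _ <= X]mul1r ler_pdivlMr; first lra.
  by rewrite lt_neqAle eq_sym nz/= mulr_ge0.
set M := sup _.
have [iY EY] := expectation_gap_bound hr_proper hr_convex hproj hell hF hFil
  hgamma0 hsgda hsigma0 hkey K M.
have x0E w : x 0%N w = x0 by case: hsgda.
have hprox k w : is_prox gamma r (x k w - gamma *: g k w) (x k.+1 w).
  by case: hsgda.
set Y := (fun w => _) in iY EY.
apply: (le_trans (ge0_le_integral_nomeas P (g := EFin \o Y) _ _)).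
- by move=> w; apply: (gap_ge0 hproj).
- move=> w; rewrite /Y /M -(x0E w).
  exact: (gap_avg_le hr_proper hr_convex hell hF hgamma0 gell
    (x := fun k => x k w) (g := fun k => g k w) (hprox ^~ w) hS_compact hK).
rewrite -(fineK (integrable_fin_num measurableT iY)) lee_fin.
rewrite -[X in X <= _]/(Rintegral P setT Y) EY.
apply: rate_bound => //; first exact: ltW.
- exact: sqr_ge0.
- exact: sqr_ge0.
exact: (sum_variance_le hr_proper hr_convex hproj hell hF hFil hgamma0 hsgda
  hsigma0 hkey).
Qed.
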